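(* Let $(P,\mathcal S)$ be a polygonal tree system associated with a convex polygon $P\subset\mathbb R^2$ with $n$ vertices, let $K$ be its attractor, let $\pi:I^\infty\to K$ be the address map, and let $\theta_{\min}$ be the smallest vertex angle of $P$. Then: (i) for any $x\in K$, the set $\pi^{-1}(x)$ contains no more than $(n-1)\left(\left\lceil\frac{2\pi}{\theta_{\min}}\right\rceil-1\right)$ elements (in this bound $\pi$ denotes the number $3.14\ldots$); (ii) the system $\mathcal S$ is post-critically finite, i.e. its post-critical set is finite.
   Context: A polygon is understood as a compact region of the plane with nonempty interior. Let $P\subset\mathbb R^2$ be a convex polygon with vertices $A_1,\dots,A_n$, and let $\mathcal S=\{S_1,\dots,S_m\}$ be a finite system of contracting similarities of $\mathbb R^2$ (maps with $|S_i(x)-S_i(y)|=r_i|x-y|$ for all $x,y$, where $0<r_i<1$). Put $P_k=S_k(P)$. The system $(P,\mathcal S)$ is called a polygonal tree system associated with $P$ if: (D1) $P_k\subset P$ for all $k$; (D2) for $i\ne j$, $P_i\cap P_j$ is either empty or consists of exactly one point which is a common vertex of $P_i$ and $P_j$; (D3) for every vertex $A_k$ of $P$ there is an $i$ with $A_k\in P_i$; (D4) the set $\widetilde P=\bigcup_{i=1}^m P_i$ is contractible. The attractor of $\mathcal S$ is the unique nonempty compact set $K\subset\mathbb R^2$ with $K=\bigcup_{i=1}^m S_i(K)$. Notation: $I=\{1,\dots,m\}$, $I^*=\bigcup_{k\ge1}I^k$, $S_{\mathbf j}=S_{j_1}\circ\cdots\circ S_{j_k}$ for $\mathbf j=j_1\dots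 j_k$; $I^\infty$ is the set of infinite sequences $\alpha=\alpha_1\alpha_2\dots$ with $\alpha_i\in I$; the address map $\pi:I^\infty\to K$ sends $\alpha$ to the unique point of $\bigcap_{k\ge1}S_{\alpha_1\dots\alpha_k}(K)$. The critical set is $\mathcal C=\bigcup_{i\ne j}S_i(K)\cap S_j(K)$, and the post-critical set is the set of all $\alpha\in I^\infty$ such that $S_{\mathbf j}(\pi(\alpha))\in\mathcal C$ for some $\mathbf j\in I^*$. $\lceil t\rceil$ is the least integer $\ge t$. *)

(* Defs.v *)
From HB Require Import structures.
From mathcomp Require Import all_boot all_order all_algebra.
From mathcomp Require Import all_classical all_reals all_analysis.

Set Implicit Arguments.
Unset Strict Implicit.
Unset Printing Implicit Defensive.

Import Order.TTheory GRing.Theory Num.Theory.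
Import numFieldNormedType.Exports.

Local Open Scope classical_set_scope.
Local Open Scope ring_scope.

(* The library norm on matrices is the sup norm. It induces the usual topology
   of the plane, but distances and angles need the Euclidean structure. *)
Definition dot (R : realType) (u v : 'rV[R]_2) : R := \sum_(i < 2) u 0 i * v 0 i.

Definition enorm (R : realType) (u : 'rV[R]_2) : R := Num.sqrt (dot u u).

Definition edist (R : realType) (x y : 'rV[R]_2) : R := enorm (x - y).

Definition angle (R : realType) (u v : 'rV[R]_2) : R :=
  acos (dot u v / (enorm u * enorm v)).

Definition contracting_similarity (R : realType) (f : 'rV[R]_2 -> 'rV[R]_2) :=
  exists r : R,
    [/\ 0 < r, r < 1 & forall x y, edist (f x) (f y) = r * edist x y].

Definition convex_hull (R : realType) (X : set 'rV[R]_2) : set 'rV[R]_2 :=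
  smallest (@convex_set R 'rV[R]_2) X.

Definition segment (R : realType) (x y : 'rV[R]_2) : set 'rV[R]_2 :=
  [set (1 - t) *: x + t *: y | t in `[0, 1]].

(* The vertices of a convex polygon are its extreme points. *)
Definition vertices (R : realType) (Q : set 'rV[R]_2) : set 'rV[R]_2 :=
  [set x | Q x /\ forall (y z : 'rV[R]_2) (t : R), Q y -> Q z ->
             0 < t -> t < 1 -> x = (1 - t) *: y + t *: z -> y = z].

Definition boundary (T : topologicalType) (X : set T) : set T :=
  closure X `\` X°.

(* The vertices are listed in cyclic order (in either direction) along the
   boundary: ordS and ord_pred are the successor and predecessor modulo n, and
   the segments [A i, A (ordS i)] are the sides. Nonempty interior forces
   3 <= n. *)
Definition convex_polygon (R : realType) (n : nat) (A : 'I_n -> 'rV[R]_2)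
    (P : set 'rV[R]_2) :=
  [/\ P = convex_hull (range A),
      P° !=set0,
      injective A,
      range A = vertices P
    & forall i, segment (A i) (A (ordS i)) `<=` boundary P].

Definition vertex_angle (R : realType) (n : nat) (A : 'I_n -> 'rV[R]_2)
    (k : 'I_n) : R :=
  angle (A (ord_pred k) - A k) (A (ordS k) - A k).

Definition min_vertex_angle (R : realType) (n : nat) (A : 'I_n -> 'rV[R]_2) : R :=
  inf (range (vertex_angle A)).

Definition contractible (R : realType) (T : topologicalType) (X : set T) :=
  exists (x0 : T) (H : T * R -> T),
    [/\ X x0,
        {within X `*` `[0, 1], continuous H},
        forall x t, X x -> 0 <= t <= 1 -> X (H (x, t)),
        forall x, X x -> H (x, 0) = x
      & forall x, X x -> H (x, 1) = x0].

Definition polygonal_tree_system (R : realType) (n m : nat)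
    (A : 'I_n -> 'rV[R]_2) (P : set 'rV[R]_2)
    (S : 'I_m -> 'rV[R]_2 -> 'rV[R]_2) :=
  [/\ convex_polygon A P /\ (forall i, contracting_similarity (S i)),
      forall k, S k @` P `<=` P,
      forall i j, i != j ->
        (S i @` P) `&` (S j @` P) = set0 \/
        exists x, [/\ (S i @` P) `&` (S j @` P) = [set x],
                      vertices (S i @` P) x & vertices (S j @` P) x],
      forall k, exists i, (S i @` P) (A k)
    & contractible R (\bigcup_(i : 'I_m) (S i @` P))].

Definition attractor (R : realType) (m : nat)
    (S : 'I_m -> 'rV[R]_2 -> 'rV[R]_2) (K : set 'rV[R]_2) :=
  [/\ K !=set0, compact K & K = \bigcup_(i : 'I_m) (S i @` K)].

(* S_{j_1 ... j_k} = S_{j_1} \o ... \o S_{j_k} *)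
Definition word_map (R : realType) (m : nat)
    (S : 'I_m -> 'rV[R]_2 -> 'rV[R]_2) (w : seq 'I_m) : 'rV[R]_2 -> 'rV[R]_2 :=
  foldr (fun i f => S i \o f) id w.

(* Infinite words are indexed from 0; mkseq a k is the prefix of length k. When K
   is the attractor of contractions, the intersection is a singleton and get
   returns its element. *)
Definition address_map (R : realType) (m : nat)
    (S : 'I_m -> 'rV[R]_2 -> 'rV[R]_2) (K : set 'rV[R]_2)
    (a : nat -> 'I_m) : 'rV[R]_2 :=
  get (\bigcap_(k in [set k | (1 <= k)%N]) (word_map S (mkseq a k) @` K)).

Definition critical_set (R : realType) (m : nat)
    (S : 'I_m -> 'rV[R]_2 -> 'rV[R]_2) (K : set 'rV[R]_2) : set 'rV[R]_2 :=
  [set x | exists i j, i != j /\ ((S i @` K) `&` (S j @` K)) x].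

Definition post_critical_set (R : realType) (m : nat)
    (S : 'I_m -> 'rV[R]_2 -> 'rV[R]_2) (K : set 'rV[R]_2) : set (nat -> 'I_m) :=
  [set a | exists w : seq 'I_m,
     w != [::] /\ critical_set S K (word_map S w (address_map S K a))].

Definition post_critically_finite (R : realType) (m : nat)
    (S : 'I_m -> 'rV[R]_2 -> 'rV[R]_2) (K : set 'rV[R]_2) :=
  finite_set (post_critical_set S K).

(* Main.v *)
Require Import Defs.
From HB Require Import structures.
From mathcomp Require Import all_boot all_order all_algebra.
From mathcomp Require Import ring lra zify.
From mathcomp Require Import all_classical all_reals all_analysis.

(** Fix a level L. Two distinct words w, w' of length L split after a common
    prefix, so the pieces S_w(P) and S_w'(P) lie in the images, under one
    similarity, of two different first-level pieces. These meet in at most one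
    point, a vertex of both; and an extreme point of a set is extreme in every
    subset containing it. Hence if x lies in both pieces, then x is their only
    common point and a vertex of each ([pieces_common_point]).

    Since K is contained in P, a point x with M >= 2 distinct addresses lies, at
    a level where all the prefixes differ, in M such pieces. Each of them is
    similar to P and contains a triangle with apex x whose angle is a vertex
    angle of P, hence at least t = theta_min. The M cones spanned by these
    triangles meet only at x, which forces M < 2 pi / t
    ([disjoint_cones_bound]): if the bisectors of two cones made an angle of at
    most t, the sum of the unit bisectors would be within t / 2 of both and so
    lie in both cones. The directions of the bisectors are therefore more than t
    apart on a circle of length 2 pi. Thus x has at most
    ceil(2 pi / t) - 1 addresses ([distinct_addresses_bound]), and the stated
    bound follows as n - 1 >= 1.

    For post-critical finiteness, let S_w(pi(a)) be critical with w nonempty.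
    This point lies in the piece of the first letter of w and in another
    first-level piece, so it is a vertex of the former; applying inverses, and
    again because extreme points are inherited by subsets, pi(a) is a vertex of P
    ([post_critical_vertex]). So the post-critical set is contained in a union of
    n fibres of pi, which are finite by the first part. *)

Set Implicit Arguments.
Unset Strict Implicit.
Unset Printing Implicit Defensive.

Import Order.TTheory GRing.Theory Num.Theory.
Import numFieldNormedType.Exports.

Local Open Scope classical_set_scope.
Local Open Scope ring_scope.

(* The extended-real distance of the library has the same name. *)
Local Notation edist := Defs.edist.

(** * Directions in the plane *)

Definition det2 (R : realType) (u v : 'rV[R]_2) : R :=
  u 0 0 * v 0 1 - u 0 1 * v 0 0.

Lemma dotE (R : realType) (u v : 'rV[R]_2) :
  dot u v = u 0 0 * v 0 0 + u 0 1 * v 0 1.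
Proof.
have e : lift ord0 ord0 = 1 :> 'I_2 by exact/val_inj.
by rewrite /dot big_ord_recl big_ord1 e.
Qed.

Lemma rV2P (R : realType) (u v : 'rV[R]_2) :
  u 0 0 = v 0 0 -> u 0 1 = v 0 1 -> u = v.
Proof.
move=> h0 h1; apply/rowP => -[[|[|//]] p].
- by rewrite (_ : Ordinal p = 0) //; exact/val_inj.
- by rewrite (_ : Ordinal p = 1) //; exact/val_inj.
Qed.

Lemma dot_eq0 (R : realType) (u : 'rV[R]_2) : dot u u = 0 -> u = 0.
Proof.
rewrite dotE => h; apply: rV2P; rewrite mxE; nra.
Qed.

Lemma dot_ge0 (R : realType) (u : 'rV[R]_2) : 0 <= dot u u.
Proof. by rewrite dotE; nra. Qed.

Lemma lagrange_identity (R : realType) (u v : 'rV[R]_2) :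
  dot u v ^+ 2 + det2 u v ^+ 2 = dot u u * dot v v.
Proof. by rewrite !dotE /det2; ring. Qed.

Lemma unit_polar (R : realType) (b : 'rV[R]_2) : dot b b = 1 ->
  exists a : R, [/\ - pi < a, a <= pi, b 0 0 = cos a & b 0 1 = sin a].
Proof.
rewrite dotE; set x := b 0 0; set y := b 0 1 => h.
have hx : -1 <= x <= 1 by apply/andP; split; nra.
have c0 := acos_ge0 hx; have c1 := acos_lepi hx; have p0 := @pi_gt0 R.
have hc : cos (acos x) = x by rewrite acosK // in_itv.
have hs : sin (acos x) = `|y|.
  rewrite sin_acos // (_ : 1 - x ^+ 2 = y ^+ 2) ?sqrtr_sqr //.
  by rewrite -h; ring.
case: (leP 0 y) => hy.
  by exists (acos x); split; [lra|lra|by rewrite hc|by rewrite hs ger0_norm].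
have lpi : acos x < pi by apply: acos_ltpi; apply/andP; split; nra.
exists (- acos x); split; [lra|lra|by rewrite cosN hc|].
by rewrite sinN hs ltr0_norm // opprK.
Qed.

Lemma cos_norm (R : realType) (x : R) : cos `|x| = cos x.
Proof. by case: (ler0P x) => _; rewrite ?cosN. Qed.

(** For the difference d of two arguments in a half-open interval of length
    2 pi, a small cosine keeps the two directions apart on the circle: d stays
    away from 0 and also from 2 pi. *)
Lemma cos_lt_far (R : realType) (t d : R) : 0 < t -> t <= pi ->
  0 <= d -> d < 2 * pi -> cos d < cos t -> t < d /\ d < 2 * pi - t.
Proof.
move=> t0 tpi d0 d2 h.
have mono x y : 0 <= x <= pi -> 0 <= y <= pi -> (cos x < cos y) = (y < x).
  by move=> hx hy; rewrite ltr_cos // in_itv.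
have [dpi|dpi] := leP d pi.
  move: h; rewrite mono; [|by rewrite d0|by rewrite (ltW t0)].
  by move=> h; split=> //; lra.
have e : cos d = cos (2 * pi - d).
  by rewrite -cosN -(cosD2pi (- d)); congr cos; rewrite -mulr_natl; ring.
move: h; rewrite e mono; last by rewrite (ltW t0).
  by move=> h; split; lra.
by apply/andP; split; lra.
Qed.

(** Measure arguments from the smallest one. Separation across the wrap-around
    leaves all of them below 2 pi - t, and half-open bins of width t contain at
    most one each, so the number of vectors is at most the number of bins that
    start below 2 pi - t. *)
Lemma separated_unit_vectors (R : realType) (M : nat) (b : 'I_M -> 'rV[R]_2)
    (t : R) : 0 < t -> t <= pi -> (forall i, dot (b i) (b i) = 1) ->
  (forall i j, i != j -> dot (b i) (b j) < cos t) ->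
  M%:Z <= Num.ceil (2 * pi / t) - 1.
Proof.
move=> t0 tpi b1 sep.
have p0 := @pi_gt0 R.
have q0 : 2 <= 2 * pi / t by rewrite ler_pdivlMr //; lra.
have c2 : 2 <= Num.ceil (2 * pi / t).
  by have := le_trans q0 (ceil_ge (2 * pi / t)); rewrite (ler_int R 2).
case: M b b1 sep => [|M] b b1 sep; first by lia.
have /choice[a ha] i := unit_polar (b1 i).
have far i j : i != j -> t < `|a i - a j| /\ `|a i - a j| < 2 * pi - t.
  move=> ij; apply: cos_lt_far => //.
  - have [? ? _ _] := ha i; have [? ? _ _] := ha j.
    by rewrite ltr_norml; apply/andP; split; lra.
  - rewrite (_ : cos _ = dot (b i) (b j)); first exact: sep.
    have [_ _ ci si] := ha i; have [_ _ cj sj] := ha j.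
    by rewrite dotE ci si cj sj -cosB cos_norm.
have [i0 _ hmin] : exists2 i0, true & forall i, a i0 <= a i.
  by case: (@arg_minP _ _ _ (ord0 : 'I_M.+1) xpredT a erefl) => i0 _ h; exists i0 => // i; apply: h.
pose B := `|Num.ceil (2 * pi / t) - 1|%N.
have BE : B%:Z = Num.ceil (2 * pi / t) - 1 by rewrite /B; lia.
(* The index of the bin containing the i-th argument. *)
pose f i := Num.truncn ((a i - a i0) / t).
have f0 i : 0 <= (a i - a i0) / t by rewrite divr_ge0 // ?(ltW t0) // subr_ge0.
have fi i : (f i)%:R <= (a i - a i0) / t < (f i).+1%:R by apply: truncn_itv.
have fB i : (f i < B)%N.
  have h : (a i - a i0) / t < 2 * pi / t - 1.
    rewrite [ltRHS](_ : _ = (2 * pi - t) / t); last by field; exact: lt0r_neq0.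
    rewrite ltr_pM2r ?invr_gt0 //.
    have [->|ne] := eqVneq i i0; first by rewrite subrr; lra.
    have [_] := far i i0 ne; rewrite ger0_norm // subr_ge0 //.
  have := fi i => /andP[h1 _].
  suff : ((f i).+1 : int) < Num.ceil (2 * pi / t) by rewrite -ltz_nat BE; lia.
  by rewrite ceil_gt_int -pmulrn -natr1; lra.
have inj : injective (fun i => Ordinal (fB i)).
  move=> i j [] e; apply/eqP/negPn/negP => ij.
  have [+ _] := far i j ij; apply/negP; rewrite -leNgt.
  have /andP[h1 h2] := fi i; have /andP[h3 h4] := fi j.
  move: h1 h2 h3 h4; rewrite e -natr1 !ler_pdivlMr // !ltr_pdivrMr // => h1 h2 h3 h4.
  by rewrite ler_norml; apply/andP; split; lra.
by have := leq_card _ inj; rewrite !card_ord -BE.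
Qed.

(** * Planar cones with a common apex *)

Lemma dotDl (R : realType) (u v z : 'rV[R]_2) :
  dot (u + v) z = dot u z + dot v z.
Proof. by rewrite !dotE !mxE; ring. Qed.

Lemma dotDr (R : realType) (u v z : 'rV[R]_2) :
  dot z (u + v) = dot z u + dot z v.
Proof. by rewrite !dotE !mxE; ring. Qed.

Lemma dotZl (R : realType) (a : R) (u v : 'rV[R]_2) :
  dot (a *: u) v = a * dot u v.
Proof. by rewrite !dotE !mxE; ring. Qed.

Lemma dotZr (R : realType) (a : R) (u v : 'rV[R]_2) :
  dot u (a *: v) = a * dot u v.
Proof. by rewrite !dotE !mxE; ring. Qed.

Lemma dotC (R : realType) (u v : 'rV[R]_2) : dot u v = dot v u.
Proof. by rewrite !dotE; ring. Qed.

(** With unit sides at angle phi, the last hypothesis says that z is within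
    phi / 2 of u + v; squaring keeps half-angles and square roots out of the
    statement. In the coordinates z = s u + t v the two hypotheses reduce to
    s + t >= 0 and s t >= 0. *)
Lemma cap_in_cone (R : realType) (u v z : 'rV[R]_2) :
  dot u u = 1 -> dot v v = 1 -> -1 < dot u v -> dot u v < 1 ->
  0 <= dot z (u + v) ->
  (1 + dot u v) ^+ 2 * dot z z <= dot z (u + v) ^+ 2 ->
  exists s t : R, [/\ 0 <= s, 0 <= t & z = s *: u + t *: v].
Proof.
move=> u1 v1 c0 c1; set D := det2 u v.
have D0 : D != 0.
  apply/eqP => D0; have := lagrange_identity u v.
  by rewrite -/D D0 u1 v1 => h; nra.
pose s := det2 z v / D; pose t := det2 u z / D.
have zE : z = s *: u + t *: v.
  apply: rV2P; rewrite !mxE /s /t.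
  - have -> : z 0 0 = z 0 0 * D / D by rewrite mulfK.
    by rewrite /D /det2 in D0 *; field.
  - have -> : z 0 1 = z 0 1 * D / D by rewrite mulfK.
    by rewrite /D /det2 in D0 *; field.
move=> h1 h2; exists s, t; suff : 0 <= s /\ 0 <= t by case.
have e1 : dot z (u + v) = (s + t) * (1 + dot u v).
  rewrite zE !dotDl !dotDr !dotZl u1 v1 (dotC v u); ring.
have e2 : dot z z = s ^+ 2 + t ^+ 2 + 2 * (s * t) * dot u v.
  rewrite zE !dotDl !dotDr !dotZl !dotZr u1 v1 (dotC v u); ring.
move: h1 h2; rewrite e1 e2; move: s t (dot u v) c0 c1 {zE e1 e2} => s t c c0 c1.
rewrite pmulr_lge0; last lra.
move=> h1; rewrite exprMn [X in X <= _]mulrC ler_pM2r; last by rewrite exprn_gt0 //; lra.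
move=> h2.
have : 0 <= s * t by nra.
by move=> h3; split; nra.
Qed.

(** For unit vectors u and v this has norm 1, as |u + v|^2 = 2 + 2 u.v. *)
Definition bisector (R : realType) (u v : 'rV[R]_2) : 'rV[R]_2 :=
  (Num.sqrt (2 + 2 * dot u v))^-1 *: (u + v).

Lemma bisector_dot (R : realType) (u v : 'rV[R]_2) :
  dot u u = 1 -> dot v v = 1 -> -1 < dot u v ->
  dot (bisector u v) (bisector u v) = 1.
Proof.
move=> u1 v1 c0; rewrite dotZl dotZr !dotDl !dotDr u1 v1 (dotC v u).
have h : 0 < 2 + 2 * dot u v by lra.
rewrite mulrA -expr2 exprVn sqr_sqrtr ?ltW // (_ : _ + _ = 2 + 2 * dot u v).
  by rewrite mulVf // lt0r_neq0.
ring.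
Qed.

(** The direction b + bisector u v halves the angle between b and the bisector.
    When that angle is at most the angle phi of the cone, the sum is within
    phi / 2 of the bisector, so [cap_in_cone] applies. *)
Lemma sum_of_bisectors_in_cone (R : realType) (u v b : 'rV[R]_2) :
  dot u u = 1 -> dot v v = 1 -> -1 < dot u v -> dot u v < 1 ->
  dot b b = 1 -> dot u v <= dot b (bisector u v) ->
  exists s t : R, [/\ 0 <= s, 0 <= t & b + bisector u v = s *: u + t *: v].
Proof.
move=> u1 v1 c0 c1 b1 hd; set b' := bisector u v in hd *.
have b'1 : dot b' b' = 1 by exact: bisector_dot.
have q0 : 0 < Num.sqrt (2 + 2 * dot u v) by rewrite sqrtr_gt0; lra.
have q2 : Num.sqrt (2 + 2 * dot u v) ^+ 2 = 2 + 2 * dot u v.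
  by rewrite sqr_sqrtr //; lra.
have uvE : u + v = Num.sqrt (2 + 2 * dot u v) *: b'.
  by rewrite /b' /bisector scalerA divff ?scale1r // lt0r_neq0.
clearbody b'; apply: cap_in_cone => //; rewrite uvE dotZr dotDl.
  rewrite b'1.
  by rewrite mulr_ge0 ?ltW //; lra.
rewrite !dotDl !dotDr b1 b'1 (dotC b' b) exprMn q2.
move: (dot b b') (dot u v) hd c0 => d c hd c0.
have : 0 <= (1 + c) * (1 + d) * (d - c) by rewrite !mulr_ge0 //; lra.
by nra.
Qed.

Definition normalize (R : realType) (u : 'rV[R]_2) := (enorm u)^-1 *: u.

Lemma enorm_gt0 (R : realType) (u : 'rV[R]_2) : u != 0 -> 0 < enorm u.
Proof.
move=> u0; rewrite sqrtr_gt0 lt_neqAle dot_ge0 andbT eq_sym.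
by apply: contra u0 => /eqP/dot_eq0 ->.
Qed.

Lemma enormE (R : realType) (u : 'rV[R]_2) : enorm u ^+ 2 = dot u u.
Proof. by rewrite sqr_sqrtr // dot_ge0. Qed.

Lemma normalize_dot (R : realType) (u : 'rV[R]_2) :
  u != 0 -> dot (normalize u) (normalize u) = 1.
Proof.
move=> u0; have h := enorm_gt0 u0.
by rewrite dotZl dotZr -enormE mulrA -expr2 -exprMn mulVf ?expr1n // lt0r_neq0.
Qed.

Lemma angle_normalize (R : realType) (u v : 'rV[R]_2) :
  angle u v = acos (dot (normalize u) (normalize v)).
Proof. by rewrite /angle dotZl dotZr invfM; congr acos; ring. Qed.

Lemma det2_neq0 (R : realType) (u v : 'rV[R]_2) : det2 u v != 0 ->
  u != 0 /\ v != 0.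
Proof.
by move=> d; split; apply: contra d => /eqP ->; rewrite /det2 !mxE; apply/eqP; ring.
Qed.

Lemma dot_normalize_itv (R : realType) (u v : 'rV[R]_2) : det2 u v != 0 ->
  -1 < dot (normalize u) (normalize v) /\ dot (normalize u) (normalize v) < 1.
Proof.
move=> d; have [u0 v0] := det2_neq0 d.
have := lagrange_identity (normalize u) (normalize v).
rewrite !normalize_dot // => h.
have : 0 < det2 (normalize u) (normalize v) ^+ 2.
  rewrite exprn_even_gt0 //= (_ : det2 _ _ = (enorm u)^-1 * (enorm v)^-1 * det2 u v).
    by rewrite !mulf_neq0 // invr_neq0 // lt0r_neq0 // enorm_gt0.
  by rewrite /det2 !mxE; ring.
by move: h; set c := dot _ _ => h h'; split; nra.
Qed.

Lemma angle_gt0_ltpi (R : realType) (u v : 'rV[R]_2) : det2 u v != 0 ->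
  0 < angle u v /\ angle u v < pi.
Proof.
move=> /dot_normalize_itv[h1 h2]; rewrite angle_normalize; split.
  by rewrite acos_gt0 // h2 ltW.
by rewrite acos_ltpi // h1 ltW.
Qed.

(** If two unit bisectors b_i, b_j were at angle at most t, their sum would lie
    in both cones by [sum_of_bisectors_in_cone], and it does not vanish since
    cos t > -1; so the bisectors are separated in the sense of
    [separated_unit_vectors]. *)
Lemma disjoint_cones_bound (R : realType) (M : nat) (u v : 'I_M -> 'rV[R]_2)
    (t : R) : 0 < t -> t <= pi ->
  (forall i, det2 (u i) (v i) != 0) -> (forall i, t <= angle (u i) (v i)) ->
  (forall i j (s1 t1 s2 t2 : R), i != j ->
     0 <= s1 -> 0 <= t1 -> 0 <= s2 -> 0 <= t2 ->
     s1 *: u i + t1 *: v i = s2 *: u j + t2 *: v j ->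
     s1 *: u i + t1 *: v i = 0) ->
  M%:Z <= Num.ceil (2 * pi / t) - 1.
Proof.
move=> t0 tpi hdet hang disj.
pose u' i := normalize (u i); pose v' i := normalize (v i).
have u1 i : dot (u' i) (u' i) = 1 by apply: normalize_dot; case: (det2_neq0 (hdet i)).
have v1 i : dot (v' i) (v' i) = 1 by apply: normalize_dot; case: (det2_neq0 (hdet i)).
have c0 i : -1 < dot (u' i) (v' i) by case: (dot_normalize_itv (hdet i)).
have c1 i : dot (u' i) (v' i) < 1 by case: (dot_normalize_itv (hdet i)).
have ct i : dot (u' i) (v' i) <= cos t.
  have [a0 api] := angle_gt0_ltpi (hdet i).
  rewrite -[leLHS]acosK; last by rewrite in_itv /= !ltW.
  rewrite -angle_normalize leNgt ltr_cos ?in_itv /= ?(ltW t0) ?(ltW a0) ?(ltW api) //.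
  by rewrite -leNgt hang.
pose b i := bisector (u' i) (v' i).
have b1 i : dot (b i) (b i) = 1 by exact: bisector_dot.
apply: (separated_unit_vectors t0 tpi b1) => i j ij.
rewrite ltNge; apply/negP => hd.
have [s1 [t1 [s10 t10 e1]]] : exists s t : R,
    [/\ 0 <= s, 0 <= t & b j + b i = s *: u' i + t *: v' i].
  by apply: sum_of_bisectors_in_cone => //; apply: le_trans (ct i) _; rewrite dotC.
have [s2 [t2 [s20 t20 e2]]] : exists s t : R,
    [/\ 0 <= s, 0 <= t & b i + b j = s *: u' j + t *: v' j].
  by apply: sum_of_bisectors_in_cone => //; apply: le_trans (ct j) _.
rewrite addrC e2 /u' /v' /normalize !scalerA in e1.
have z0 : b i + b j = 0.
  rewrite e2 /u' /v' /normalize !scalerA e1.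
  by apply: (disj i j _ _ _ _ ij) (esym e1); rewrite ?mulr_ge0 // invr_ge0 sqrtr_ge0.
have : dot (b i + b j) (b i) = 0 by rewrite z0 dotE !mxE; ring.
rewrite dotDl b1 (dotC (b j)) => h.
(* Here -1 < u'.v' <= cos t <= b_i.b_j, whereas b_i + b_j = 0 gives b_i.b_j = -1. *)
by have := c0 i; have := ct i; lra.
Qed.

(** * Convex sets, similarities and extreme points *)

Lemma convex_set_conv (R : realType) (X : set 'rV[R]_2) (x y : 'rV[R]_2)
    (t : R) : @convex_set R 'rV[R]_2 X -> X x -> X y -> 0 <= t -> t <= 1 ->
  X ((1 - t) *: x + t *: y).
Proof.
move=> cX Xx Xy t0 t1.
have t01 : Itv.spec (Itv.num_sem (R:=R)) (Itv.Real `[0%Z, 1%Z]) t.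
  by rewrite /= /Itv.num_sem /= ger0_real //= in_itv /= t0 t1.
have := cX y x (Itv.mk t01) (mem_set Xy) (mem_set Xx).
by move=> /set_mem; rewrite addrC.
Qed.

Lemma convex_set_of_conv (R : realType) (X : set 'rV[R]_2) :
  (forall x y (t : R), X x -> X y -> 0 <= t -> t <= 1 ->
    X ((1 - t) *: x + t *: y)) -> @convex_set R 'rV[R]_2 X.
Proof.
move=> cX x y t /set_mem Xx /set_mem Xy; apply/mem_set.
have := cX y x t%:num Xy Xx; rewrite addrC; apply => //.
Qed.

Lemma convex_hull_convex (R : realType) (X : set 'rV[R]_2) :
  @convex_set R 'rV[R]_2 (convex_hull X).
Proof.
apply: convex_set_of_conv => x y t Xx Xy t0 t1 C [cC XC].
by apply: convex_set_conv => //; [apply: Xx|apply: Xy].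
Qed.

Lemma convex_triangle (R : realType) (X : set 'rV[R]_2) (x y z : 'rV[R]_2)
    (s t : R) : @convex_set R 'rV[R]_2 X -> X x -> X y -> X z ->
  0 <= s -> 0 <= t -> s + t <= 1 ->
  X (x + (s *: (y - x) + t *: (z - x))).
Proof.
move=> cX Xx Xy Xz s0 t0 st.
have [st0|st0] := eqVneq (s + t) 0.
  have -> : s = 0 by lra.
  have -> : t = 0 by lra.
  by rewrite !scale0r !addr0.
have h : 0 < s + t by rewrite lt_neqAle eq_sym st0 addr_ge0.
have -> : x + (s *: (y - x) + t *: (z - x)) =
    (1 - (s + t)) *: x + (s + t) *: ((1 - t / (s + t)) *: y + (t / (s + t)) *: z).
  by apply: rV2P; rewrite !mxE; field.
apply: convex_set_conv => //; last exact: ltW.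
apply: convex_set_conv => //; first by rewrite divr_ge0 // ltW.
by rewrite ler_pdivrMr // mul1r lerDr.
Qed.

Definition similarity (R : realType) (f : 'rV[R]_2 -> 'rV[R]_2) :=
  exists2 r : R, 0 < r & forall x y, edist (f x) (f y) = r * edist x y.

Lemma similarity_id (R : realType) : similarity (@id 'rV[R]_2).
Proof. by exists 1 => // x y; rewrite mul1r. Qed.

Lemma similarity_comp (R : realType) (f g : 'rV[R]_2 -> 'rV[R]_2) :
  similarity f -> similarity g -> similarity (f \o g).
Proof.
move=> [r r0 fr] [s s0 gs]; exists (r * s); first exact: mulr_gt0.
by move=> x y /=; rewrite fr gs mulrA.
Qed.

Lemma edist_dot (R : realType) (x y : 'rV[R]_2) :
  edist x y ^+ 2 = dot (x - y) (x - y).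
Proof. exact: enormE. Qed.

(** Polarization: inner products of difference vectors are determined by the
    three mutual distances. *)
Lemma similarity_dot (R : realType) (f : 'rV[R]_2 -> 'rV[R]_2) (r : R) :
  (forall x y, edist (f x) (f y) = r * edist x y) ->
  forall x y z, dot (f y - f x) (f z - f x) = r ^+ 2 * dot (y - x) (z - x).
Proof.
move=> fr x y z.
have d a b : dot (f a - f b) (f a - f b) = r ^+ 2 * dot (a - b) (a - b).
  by rewrite -!edist_dot fr exprMn.
have pol (u v w : 'rV[R]_2) : dot (v - u) (w - u) =
    (dot (v - u) (v - u) + dot (w - u) (w - u) - dot (v - w) (v - w)) / 2.
  by rewrite !dotE !mxE; field.
by rewrite pol !d [in RHS]pol; field.
Qed.

(** No linearity is assumed of a similarity: it is affine on segments because,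
    with W = f q - f x and V = f y - f x, the inner products given by
    [similarity_dot] make |W - t V|^2 vanish. *)
Lemma similarity_conv (R : realType) (f : 'rV[R]_2 -> 'rV[R]_2) :
  similarity f -> forall x y (t : R),
  f ((1 - t) *: x + t *: y) = (1 - t) *: f x + t *: f y.
Proof.
move=> [r r0 fr] x y t; set q := (1 - t) *: x + t *: y.
have qx : q - x = t *: (y - x) by rewrite /q; apply: rV2P; rewrite !mxE; ring.
have D := similarity_dot fr x.
suff h : f q - f x - t *: (f y - f x) = 0.
  move/eqP: h; rewrite subr_eq0 => /eqP h.
  by rewrite -[LHS](subrK (f x)) h; apply: rV2P; rewrite !mxE; ring.
apply: dot_eq0; set W := f q - f x; set V := f y - f x.
have -> : dot (W - t *: V) (W - t *: V) = dot W W - 2 * t * dot W V + t ^+ 2 * dot V V.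
  by rewrite !dotE !mxE; ring.
by rewrite /W /V !D qx !dotZl !dotZr; ring.
Qed.

Lemma similarity_inj (R : realType) (f : 'rV[R]_2 -> 'rV[R]_2) :
  similarity f -> injective f.
Proof.
move=> [r r0 fr] x y e; apply/eqP; rewrite -subr_eq0; apply/eqP/dot_eq0.
have := fr x y; rewrite e => h.
have h1 : edist (f y) (f y) = 0 by rewrite /edist subrr /enorm dotE !mxE !mul0r addr0 sqrtr0.
have : edist x y = 0 by move/eqP: h; rewrite h1 eq_sym mulf_eq0 (gt_eqF r0) => /eqP.
by move=> h2; rewrite -edist_dot h2 expr0n.
Qed.

Lemma similarity_angle (R : realType) (f : 'rV[R]_2 -> 'rV[R]_2) x y z :
  similarity f -> angle (f y - f x) (f z - f x) = angle (y - x) (z - x).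
Proof.
move=> [r r0 fr]; rewrite /angle (similarity_dot fr).
have e a b : enorm (f a - f b) = r * enorm (a - b) by exact: fr.
rewrite !e; congr acos; rewrite mulrACA -expr2 invfM mulrACA divff ?mul1r //.
by rewrite lt0r_neq0 // exprn_gt0.
Qed.

(** By the Lagrange identity det^2 is a function of inner products, so it is
    scaled by r^4; only its vanishing is independent of orientation. *)
Lemma similarity_det2 (R : realType) (f : 'rV[R]_2 -> 'rV[R]_2) x y z :
  similarity f ->
  (det2 (f y - f x) (f z - f x) == 0) = (det2 (y - x) (z - x) == 0).
Proof.
move=> [r r0 fr]; have D := similarity_dot fr x.
have := lagrange_identity (f y - f x) (f z - f x).
have := lagrange_identity (y - x) (z - x).
rewrite !D => h1 h2.
have {h1}h2 : det2 (f y - f x) (f z - f x) ^+ 2 = r ^+ 4 * det2 (y - x) (z - x) ^+ 2.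
  apply: (addrI ((r ^+ 2 * dot (y - x) (z - x)) ^+ 2)); rewrite h2.
  by rewrite exprMn -exprM -mulrDr h1; ring.
by rewrite -sqrf_eq0 h2 mulf_eq0 !expf_eq0 /= (gt_eqF r0).
Qed.

Lemma similarity_convex (R : realType) (f : 'rV[R]_2 -> 'rV[R]_2) X :
  similarity f -> @convex_set R 'rV[R]_2 X ->
  @convex_set R 'rV[R]_2 (f @` X).
Proof.
move=> sf cX; apply: convex_set_of_conv => _ _ t [x Xx <-] [y Xy <-] t0 t1.
exists ((1 - t) *: x + t *: y); first exact: convex_set_conv.
exact: similarity_conv.
Qed.

Lemma vertices_similarity (R : realType) (f : 'rV[R]_2 -> 'rV[R]_2) X p :
  similarity f -> vertices (f @` X) (f p) -> vertices X p.
Proof.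
move=> sf [[q Xq /(similarity_inj sf) qp] ext]; split; first by rewrite -qp.
move=> y z t Xy Xz t0 t1 e; apply: (similarity_inj sf).
apply: (ext _ _ t) => //.
by rewrite e; apply: similarity_conv.
Qed.

Lemma vertices_sub (R : realType) (X Y : set 'rV[R]_2) x :
  X `<=` Y -> X x -> vertices Y x -> vertices X x.
Proof.
move=> XY Xx [_ ext]; split=> // y z t Xy Xz; apply: ext; exact: XY.
Qed.

(** Of three distinct collinear points one lies strictly between the other two,
    which an extreme point never does. *)
Lemma vertices_noncollinear (R : realType) (X : set 'rV[R]_2) x y z :
  vertices X x -> vertices X y -> vertices X z ->
  x != y -> x != z -> y != z -> det2 (y - x) (z - x) != 0.
Proof.
move=> [Xx ex] [Xy ey] [Xz ez] xy xz yz; apply/eqP => d0.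
have [l hl] : exists l : R, z - x = l *: (y - x).
  have n0 : dot (y - x) (y - x) != 0.
    by apply: contra xy => /eqP/dot_eq0/eqP; rewrite subr_eq0 eq_sym.
  exists (dot (y - x) (z - x) / dot (y - x) (y - x)).
  apply: (scalerI n0); rewrite scalerA mulrCA divff // mulr1.
  move: (y - x) (z - x) d0 {n0} => u v; rewrite /det2 => d0.
  apply: rV2P; rewrite !mxE !dotE.
    by rewrite -[RHS]subr0 -(mulr0 (u 0 1)) -d0; ring.
  by rewrite -[RHS]addr0 -(mulr0 (u 0 0)) -d0; ring.
have zE : z = (1 - l) *: x + l *: y.
  by rewrite -[LHS](subrK x) hl; apply: rV2P; rewrite !mxE; ring.
(* The middle point is x for l < 0, z for 0 < l < 1 and y for 1 < l. *)
case: (ltrgtP l 0) => l0.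
- have l1 : 1 - l != 0 by lra.
  suff e : z = y by rewrite e eqxx in yz.
  apply: (ex _ _ ((- l) / (1 - l))) => //.
  + by rewrite divr_gt0 //; lra.
  + by rewrite ltr_pdivrMr; lra.
  + by rewrite zE; apply: rV2P; rewrite !mxE; field.
- case: (ltrgtP l 1) => l1.
  + by move: xy; rewrite (ez _ _ l Xx Xy) // eqxx.
  + suff e : x = z by rewrite e eqxx in xz.
    apply: (ey _ _ l^-1) => //; first by rewrite invr_gt0.
      by rewrite invf_lt1.
    by rewrite zE; apply: rV2P; rewrite !mxE; field; exact: lt0r_neq0.
  + by move: yz; rewrite zE l1 subrr scale0r add0r scale1r eqxx.
- by move: xz; rewrite zE l0 subr0 scale0r addr0 scale1r eqxx.
Qed.

(** * Topology of hulls and similarities *)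

(** The total weight is left arbitrary, as a normalized statement would not go
    through the induction on the list. *)
Lemma convex_sum (R : realType) (X : set 'rV[R]_2) (n : nat)
    (A : 'I_n -> 'rV[R]_2) (w : 'I_n -> R) (r : seq 'I_n) :
  @convex_set R 'rV[R]_2 X -> X !=set0 -> (forall i, X (A i)) ->
  (forall i, 0 <= w i) ->
  exists2 y, X y & \sum_(i <- r) w i *: A i = (\sum_(i <- r) w i) *: y.
Proof.
move=> cX [x0 Xx0] XA w0; elim: r => [|i r [y Xy IH]].
  by exists x0; rewrite // !big_nil scale0r.
rewrite !big_cons IH; set W := \sum_(j <- r) w j.
have W0 : 0 <= W by apply: sumr_ge0.
have [e|ne] := eqVneq (w i + W) 0.
  exists x0 => //; have := w0 i => wi.
  have -> : w i = 0 by lra.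
  have -> : W = 0 by lra.
  by rewrite addr0 !scale0r addr0.
have h : 0 < w i + W by rewrite lt_neqAle eq_sym ne addr_ge0.
exists ((1 - W / (w i + W)) *: A i + (W / (w i + W)) *: y).
  apply: convex_set_conv => //; first by rewrite divr_ge0 // ltW.
  by rewrite ler_pdivrMr // mul1r lerDr.
by apply: rV2P; rewrite !mxE; field.
Qed.

(** The hull is the image of the standard simplex, which is compact, under the
    continuous map sending weights to the weighted sum of the points. *)
Lemma convex_hull_compact (R : realType) (n : nat) (A : 'I_n -> 'rV[R]_2) :
  compact (convex_hull (range A)).
Proof.
case: n A => [A|n A].
  (* The hull of no point is empty. *)
  rewrite (_ : convex_hull _ = set0); first exact: compact0.
  apply/seteqP; split=> // x /(_ set0); apply; split.
    by apply: convex_set_of_conv => ? ? ? [].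

  by move=> y [[]].
pose D := [set s : 'rV[R]_n.+1 | (forall i, `[0, 1]%classic (s ord0 i))] `&`
  [set s | \sum_i s ord0 i = 1].
pose F (s : 'rV[R]_n.+1) := \sum_i s ord0 i *: A i.
have contS (V : normedModType R) (G : 'I_n.+1 -> 'rV[R]_n.+1 -> V) :
    (forall i, continuous (G i)) -> continuous (fun s => \sum_i G i s).
  move=> cG; rewrite (_ : (fun s => _) = \sum_i G i); last first.
    by apply/funext => s; rewrite fct_sumE.
  apply: (big_ind (fun h : 'rV[R]_n.+1 -> V => continuous h)) => //.
    exact: cst_continuous.
  by move=> f g cf cg x; apply: continuousD; [apply: cf|apply: cg].
have cD : compact D.
  apply: compact_closedI.
    apply: (@rV_compact R _ (fun=> `[(0:R), 1]%classic)) => i; exact: segment_compact.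
  apply: (@preimage_closed _ _ (fun s : 'rV[R]_n.+1 => \sum_i s ord0 i)
    [set x : R | x = 1]); last exact: closed_eq.
  by move=> x _; apply: contS => i; apply: coord_continuous.
rewrite (_ : convex_hull _ = F @` D).
  apply: continuous_compact cD; apply: continuous_subspaceT.
  apply: contS => i x; apply: continuousZ; last exact: cst_continuous.
  exact: coord_continuous.
apply/seteqP; split; last first.
  move=> _ [s [s01 s1] <-].
  have hA i : convex_hull (range A) (A i) by apply: sub_gen_smallest; exists i.
  have s0 i : 0 <= s ord0 i by have := s01 i; rewrite /= in_itv /= => /andP[].
  have ne : convex_hull (range A) !=set0 by exists (A ord0).
  have [y hy] := convex_sum (index_enum _) (@convex_hull_convex _ _) ne hA s0.
  by rewrite s1 scale1r /F => ->.
apply: smallest_sub.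
  apply: convex_set_of_conv => _ _ t [a [a01 a1] <-] [b [b01 b1] <-] t0 t1.
  exists ((1 - t) *: a + t *: b).
    split=> [i|/=].
      have := a01 i; have := b01 i; rewrite /= !in_itv /= !mxE.
      move=> /andP[h1 h2] /andP[h3 h4]; apply/andP; split; nra.
    under eq_bigr do rewrite !mxE.
    by rewrite big_split /= -!mulr_sumr a1 b1; ring.
  rewrite /F; under eq_bigr do rewrite !mxE scalerDl -!scalerA.
  by rewrite big_split /= -!scaler_sumr.
move=> _ [i _ <-]; exists (delta_mx ord0 i).
  split=> [j|/=].
    by rewrite /= in_itv /= mxE eqxx /=; case: (j == i); rewrite /= ?lexx ler01.
  rewrite (bigD1 i) //= big1 ?addr0 ?mxE ?eqxx //.
  by move=> j ji; rewrite mxE (negbTE ji).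
rewrite /F (bigD1 i) //= big1 ?addr0 ?mxE ?eqxx ?scale1r //.
by move=> j ji; rewrite mxE (negbTE ji) scale0r.
Qed.

Lemma coord_le_norm (R : realType) (u : 'rV[R]_2) i : `|u ord0 i| <= `|u|.
Proof.
rewrite [leRHS]/Num.norm /= mx_normrE; apply/bigmax_geP; right => /=.
by exists (ord0, i).
Qed.

Lemma enorm_le_norm (R : realType) (u : 'rV[R]_2) : enorm u <= 2 * `|u|.
Proof.
have h0 := coord_le_norm u 0; have h1 := coord_le_norm u 1.
have n0 := normr_ge0 u.
rewrite -(@ler_pXn2r _ 2) ?nnegrE ?sqrtr_ge0 ?mulr_ge0 // enormE dotE.
rewrite -!expr2 -(real_normK (num_real (u 0 0))) -(real_normK (num_real (u 0 1))).
have := normr_ge0 (u 0 0); have := normr_ge0 (u 0 1); nra.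
Qed.

Lemma norm_le_enorm (R : realType) (u : 'rV[R]_2) : `|u| <= enorm u.
Proof.
rewrite {1}/Num.norm /= mx_normrE; apply: bigmax_le; first exact: sqrtr_ge0.
move=> [i j] _ /=; rewrite (ord1 i) -sqrtr_sqr ler_sqrt ?dot_ge0 //.
have [->|->] : j = 0 \/ j = 1.
  by case: j => [[|[|//]] p]; [left|right]; apply/val_inj.
all: by rewrite dotE; nra.
Qed.

Lemma similarity_continuous (R : realType) (f : 'rV[R]_2 -> 'rV[R]_2) :
  similarity f -> continuous f.
Proof.
move=> [r r0 fr] x U /nbhs_ballP[e /= e0 eU].
apply/nbhs_ballP; exists ((r * 2)^-1 * e) => /=.
  by rewrite mulr_gt0 // invr_gt0 mulr_gt0.
move=> y; rewrite -ball_normE /= => xy; apply: eU; rewrite -ball_normE /=.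
apply: le_lt_trans (norm_le_enorm _) _.
have := fr x y; rewrite /edist => ->.
apply: (@le_lt_trans _ _ (r * (2 * `|x - y|))).
  by rewrite ler_pM2l // enorm_le_norm.
by rewrite mulrA -ltr_pdivlMl ?mulr_gt0.
Qed.

(** * The attractor and its addresses *)

Lemma word_map_cat (R : realType) (m : nat) (S : 'I_m -> 'rV[R]_2 -> 'rV[R]_2)
    (u v : seq 'I_m) x : word_map S (u ++ v) x = word_map S u (word_map S v x).
Proof. by elim: u => //= i u ->. Qed.

Lemma word_map_sub (R : realType) (m : nat) (S : 'I_m -> 'rV[R]_2 -> 'rV[R]_2)
    (X : set 'rV[R]_2) (w : seq 'I_m) :
  (forall i, S i @` X `<=` X) -> word_map S w @` X `<=` X.
Proof.
move=> SX; elim: w => [|i w IH] _ [x Xx <-] //=.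
by apply: (SX i); exists (word_map S w x) => //; apply: IH; exists x.
Qed.

Lemma similarity_of_contracting (R : realType) (f : 'rV[R]_2 -> 'rV[R]_2) :
  contracting_similarity f -> similarity f.
Proof. by move=> [r [r0 _ fr]]; exists r. Qed.

Lemma word_map_similarity (R : realType) (m : nat)
    (S : 'I_m -> 'rV[R]_2 -> 'rV[R]_2) (w : seq 'I_m) :
  (forall i, similarity (S i)) -> similarity (word_map S w).
Proof.
move=> sS; elim: w => [|i w IH] /=; first exact: similarity_id.
exact: similarity_comp.
Qed.

Lemma attractor_sub (R : realType) (m : nat)
    (S : 'I_m -> 'rV[R]_2 -> 'rV[R]_2) (K : set 'rV[R]_2) i :
  attractor S K -> S i @` K `<=` K.
Proof. by move=> [_ _ KE] x Sx; rewrite KE; exists i. Qed.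

Lemma attractor_word (R : realType) (m : nat)
    (S : 'I_m -> 'rV[R]_2 -> 'rV[R]_2) (K : set 'rV[R]_2) (k : nat) x :
  attractor S K -> K x -> exists2 w, size w = k & (word_map S w @` K) x.
Proof.
move=> [_ _ KE]; elim: k x => [|k IH] x Kx; first by exists [::] => //; exists x.
move: Kx; rewrite {1}KE => -[i _ [y Ky <-]].
have [w sw [z Kz zy]] := IH y Ky.
exists (i :: w); first by rewrite /= sw.
by exists z => //=; rewrite zy.
Qed.

(** A largest ratio below 1 exists because there are finitely many maps. *)
Lemma uniform_contraction_ratio (R : realType) (m : nat)
    (S : 'I_m -> 'rV[R]_2 -> 'rV[R]_2) :
  (forall i, contracting_similarity (S i)) ->
  exists q : R, [/\ 0 <= q, q < 1 &
    forall w x y, edist (word_map S w x) (word_map S w y)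
                  <= q ^+ size w * edist x y].
Proof.
move=> /choice[r hr]; pose q := \big[Num.max/0]_i r i.
have q0 : 0 <= q by exact: bigmax_ge_id.
exists q; split=> //.
  by apply: bigmax_lt => // i _; have [] := hr i.
elim=> [|i w IH] x y /=; first by rewrite expr0 mul1r.
have [r0 _ ->] := hr i; rewrite exprS -mulrA; apply: ler_pM.
- exact: ltW.
- exact: sqrtr_ge0.
- exact: le_bigmax.
- exact: IH.
Qed.

(** A point x of K is S_w(y) with y in K for words w of any length k, and S_w(p)
    is a point of P at distance at most q^k |y - p| from x. As K is bounded, x is
    in the closure of P. *)
Lemma attractor_in_invariant (R : realType) (m : nat)
    (S : 'I_m -> 'rV[R]_2 -> 'rV[R]_2) (P K : set 'rV[R]_2) :
  (forall i, contracting_similarity (S i)) -> closed P -> P !=set0 ->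
  (forall i, S i @` P `<=` P) -> attractor S K -> K `<=` P.
Proof.
move=> cS clP [p Pp] SP hK x Kx; have [_ cK _] := hK.
have [q [q0 q1 hq]] := uniform_contraction_ratio cS.
have [M [_ /(_ (M + 1))]] := compact_bounded cK.
rewrite ltrDl ltr01 => /(_ isT) hM.
(* Bounds |y - p| on K; the factor 2 compares Euclidean and sup norm. *)
pose D := 2 * (M + 1 + `|p|) + 1.
have M0 : 0 <= M + 1 by apply: le_trans (hM _ Kx).
have D0 : 0 < D by rewrite ltr_wpDl // mulr_ge0 // addr_ge0.
apply: clP => U /nbhs_ballP[e /= e0 eU].
have [k hk] : exists k, q ^+ k < e / D.
  have : (fun k => q ^+ k) @ \oo --> (0 : R) by apply: cvg_expr; rewrite ger0_norm.
  move=> /cvgrPdist_lt/(_ (e / D)); rewrite divr_gt0 // => /(_ isT)[k _ hk].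
  exists k; have := hk k (leqnn k); rewrite /= sub0r normrN ger0_norm ?exprn_ge0 //.
have [w sw [y Ky xE]] := attractor_word k hK Kx.
exists (word_map S w p); split; first by apply: (word_map_sub SP (w := w)); exists p.
apply: eU; rewrite -ball_normE /= -xE.
apply: le_lt_trans (norm_le_enorm _) _.
apply: le_lt_trans (hq _ _ _) _; rewrite sw.
apply: (@le_lt_trans _ _ (q ^+ k * D)); last by rewrite -ltr_pdivlMr.
rewrite ler_wpM2l ?exprn_ge0 //.
apply: le_trans (enorm_le_norm _) _; rewrite /D.
apply: (@le_trans _ _ (2 * (M + 1 + `|p|))); last by rewrite lerDl.
rewrite ler_pM2l //; apply: le_trans (ler_normB _ _) _.
by rewrite lerD2r; apply: hM.
Qed.

(** The sets S_prefix(K) are compact and decrease with the prefix, so they have a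
    common point, and the address map picks one. *)
Lemma address_mapP (R : realType) (m : nat)
    (S : 'I_m -> 'rV[R]_2 -> 'rV[R]_2) (K : set 'rV[R]_2) (a : nat -> 'I_m) :
  (forall i, similarity (S i)) -> attractor S K ->
  forall k, (word_map S (mkseq a k) @` K) (address_map S K a).
Proof.
move=> sS hK; have [[x0 Kx0] cK _] := hK.
pose F k := word_map S (mkseq a k) @` K.
have Fdec k l : F (k + l)%N `<=` F k.
  elim: l => [|l IH]; first by rewrite addn0.
  rewrite addnS => _ [x Kx <-]; apply: IH.
  exists (S (a (k + l)%N) x); first by apply: (attractor_sub hK); exists x.
  by rewrite mkseqS -cats1 word_map_cat.
have Fcl k : closed (F k).
  apply: compact_closed; first exact: norm_hausdorff.
  apply: continuous_compact cK; apply: continuous_subspaceT.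
  exact/similarity_continuous/word_map_similarity.
have [p hp] : exists p, forall k, F k p.
  pose y k := word_map S (mkseq a k) x0.
  have yF k n : (k <= n)%N -> F k (y n).
    by move=> kn; apply: (Fdec k (n - k)%N); rewrite subnKC //; exists x0.
  have [|p [_ pc]] := cK (y @ \oo) _.
    by exists 0 => // n _; have [z Kz] := yF 0 n (leq0n n); rewrite /= => <-.
  exists p => k; apply: Fcl => U Up.
  by apply: pc Up; exists k => // n /= kn; apply: yF.
have : \bigcap_(k in [set k | (1 <= k)%N]) F k !=set0 by exists p => k _.
move=> /getPex h [|k]; last exact: h.
by apply: (Fdec 0 1); apply: h.
Qed.

(** * Counting lemmas *)

Lemma card_le_ord (T : Type) (X : set T) (M : nat) : (`I_M #<= X)%card ->
  exists2 f : 'I_M -> T, injective f & forall i, X (f i).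
Proof.
move=> /card_leP[g].
have hM (i : 'I_M) : (i : nat) \in `I_M by apply/mem_set => /=.
exists (fun i => val (g (SigSub (hM i)))); last first.
  by move=> i; exact: set_valP.
move=> i j /val_inj /(@inj _ _ _ g) e.
by apply/val_inj; have /(congr1 val) := e (mem_set I) (mem_set I).
Qed.

(** A bound on the sizes of injective families gives finiteness together with the
    bound on the cardinality. *)
Lemma finite_card_bound (T : Type) (X : set T) (b : int) :
  (forall (M : nat) (f : 'I_M -> T), injective f -> (forall i, X (f i)) ->
    M%:Z <= b) ->
  exists2 N : nat, (X #= `I_N)%card & N%:Z <= b.
Proof.
move=> hb.
have le M : (`I_M #<= X)%card -> M%:Z <= b by move=> /card_le_ord[f]; apply: hb.
have [/finite_setP[N XN]|/infiniteP hX] := pselect (finite_set X).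
  by exists N => //; apply: le; move: XN; rewrite card_eq_le => /andP[].
exfalso; have : (`|b|.+1)%:Z <= b; last by lia.
by apply: le; apply: card_le_trans hX; apply: subset_card_le.
Qed.

Lemma eventually_distinct_prefixes (I : finType) (T : eqType)
    (f : I -> nat -> T) : injective f ->
  exists L, forall i j, i != j -> mkseq (f i) L != mkseq (f j) L.
Proof.
move=> finj.
have /choice[d hd] (p : I * I) : exists k, p.1 != p.2 -> f p.1 k != f p.2 k.
  have [e|ne] := eqVneq p.1 p.2; first by exists 0.
  suff [k hk] : exists k, f p.1 k != f p.2 k by exists k.
  apply: contrapT => h; move/eqP: ne; apply; apply: finj; apply/funext => k.
  by apply/eqP/negPn/negP => hk; apply: h; exists k.
exists (\max_p d p).+1 => i j ij; apply/eqP => e.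
have := hd (i, j) ij; rewrite /=; set k := d (i, j).
have kL : (k < (\max_p d p).+1)%N by rewrite ltnS (leq_bigmax (i, j)).
have := congr1 (fun s => nth (f i 0) s k) e.
by rewrite !nth_mkseq // => -> /eqP.
Qed.

(** * Angles of a convex polygon *)

(** Moving a short way along the normal v leaves the line. *)
Lemma interior_on_line (R : realType) (X : set 'rV[R]_2)
    (a v : 'rV[R]_2) :
  v != 0 -> (forall x, X x -> dot (x - a) v = 0) -> X° = set0.
Proof.
move=> v0 Xl; apply/seteqP; split => // x Xx.
have := Xx; rewrite /interior /= => /nbhs_ballP[e /= e0 eX].
have nv : 0 < `|v| by rewrite normr_gt0.
pose d := e / (2 * `|v|).
have d0 : 0 < d by rewrite divr_gt0 // mulr_gt0.
have h1 := Xl _ (interior_subset Xx).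
have h2 : dot (x + d *: v - a) v = 0.
  apply: Xl; apply: eX; rewrite -ball_normE /= opprD addNKr normrN normrZ.
  rewrite gtr0_norm // /d invfM mulrA mulfVK ?lt0r_neq0 //; lra.
have : dot v v != 0 by apply: contra v0 => /eqP/dot_eq0 ->.
apply/negP; rewrite negbK.
have : d * dot v v = 0.
  have -> : d * dot v v = dot (x + d *: v - a) v - dot (x - a) v.
    by rewrite !dotE !mxE; ring.
  by rewrite h1 h2 subrr.
by move=> /eqP; rewrite mulf_eq0 (gt_eqF d0).
Qed.

Lemma convex_hull_on_line (R : realType) (X : set 'rV[R]_2)
    (a v : 'rV[R]_2) : (forall x, X x -> dot (x - a) v = 0) ->
  forall x, convex_hull X x -> dot (x - a) v = 0.
Proof.
move=> Xl; apply: smallest_sub => //.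
apply: convex_set_of_conv => x y t /= hx hy _ _.
have -> : (1 - t) *: x + t *: y - a = (1 - t) *: (x - a) + t *: (y - a).
  by apply: rV2P; rewrite !mxE; ring.
by rewrite dotDl !dotZl hx hy !mulr0 addr0.
Qed.

(** At most two points lie on a line, and then so does their hull. *)
Lemma polygon_gt2 (R : realType) (n : nat) (A : 'I_n -> 'rV[R]_2)
    (P : set 'rV[R]_2) : convex_polygon A P -> (2 < n)%N.
Proof.
move=> [-> hint Ainj _ _]; rewrite ltnNge; apply/negP => n2.
suff [a [v [v0 hl]]] : exists a v : 'rV[R]_2,
    v != 0 /\ forall i, dot (A i - a) v = 0.
  move: hint; rewrite (interior_on_line v0 (a := a)) => [[]//|].
  by apply: convex_hull_on_line => _ [i _ <-].
have one0 : const_mx 1 != 0 :> 'rV[R]_2.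
  by apply/eqP => /rowP /(_ 0); rewrite !mxE => /eqP; rewrite oner_eq0.
case: n A Ainj n2 {hint} => [|[|[|//]]] A Ainj _.
- by exists 0, (const_mx 1); split=> // -[].
- exists (A ord0), (const_mx 1); split=> // i.
  by rewrite (ord1 i) subrr dotE !mxE; ring.
- set u := A 1 - A 0.
  have u0 : u != 0 by rewrite subr_eq0; apply/eqP => /Ainj.
  exists (A 0), (\row_j (if j == 0 then - u 0 1 else u 0 0)); split.
    apply: contra u0 => /eqP/rowP h; apply/eqP/rV2P.
      by have := h 1; rewrite !mxE.
    by have := h 0; rewrite !mxE /= => /eqP; rewrite oppr_eq0 => /eqP.
  move=> i; have [->|->] : i = 0 \/ i = 1.
    by case: i => [[|[|//]] p]; [left|right]; apply/val_inj.
  all: by rewrite dotE !mxE /=; ring.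
Qed.

(** From three indices on, an index and its two cyclic neighbours are distinct;
    so the vertex angle at it involves three distinct vertices. *)
Lemma ordS_neq (n : nat) (k : 'I_n) : (2 < n)%N ->
  [/\ k != ord_pred k, k != ordS k & ord_pred k != ordS k].
Proof.
move=> n2.
have S1 (i : 'I_n) : i != ordS i.
  apply/eqP => /(congr1 val) /=; have := ltn_ord i.
  rewrite leq_eqVlt => /orP[/eqP e|h]; last by rewrite modn_small //; lia.
  by rewrite e modnn; lia.
split=> //.
- by apply/eqP => e; move: (S1 (ord_pred k)); rewrite ord_predK -e eqxx.
- apply/eqP => e; have := congr1 (@ordS n) e; rewrite ord_predK.
  move=> /(congr1 val) /=; have kn := ltn_ord k.
  have [h|h] := ltnP k.+1 n.
    rewrite (modn_small h); have [h'|h'] := ltnP k.+2 n.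
      by rewrite modn_small //; lia.
    by rewrite (_ : k.+2 = n) ?modnn; lia.
  by rewrite (_ : k.+1 = n) ?modnn ?modn_small; lia.
Qed.

(** The determinant form is what survives similarities; through
    [angle_gt0_ltpi] it says that the vertex angle is strictly between 0 and
    pi. *)
Lemma vertex_angle_nonflat (R : realType) (n : nat) (A : 'I_n -> 'rV[R]_2)
    (P : set 'rV[R]_2) (k : 'I_n) : convex_polygon A P ->
  det2 (A (ord_pred k) - A k) (A (ordS k) - A k) != 0.
Proof.
move=> hP; have n2 := polygon_gt2 hP; have [k1 k2 k3] := ordS_neq k n2.
have [_ _ Ainj Av _] := hP.
have vA i : vertices P (A i) by rewrite -Av; exists i.
by apply: (vertices_noncollinear (vA k)) => //; rewrite (inj_eq Ainj).
Qed.

(** The infimum is over finitely many positive angles, so it is positive. *)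
Lemma min_vertex_angle_bounds (R : realType) (n : nat) (A : 'I_n -> 'rV[R]_2)
    (P : set 'rV[R]_2) : convex_polygon A P ->
  [/\ 0 < min_vertex_angle A, min_vertex_angle A < pi &
      forall k, min_vertex_angle A <= vertex_angle A k].
Proof.
move=> hP; have n2 := polygon_gt2 hP.
have bnd k := angle_gt0_ltpi (vertex_angle_nonflat k hP).
have le k : min_vertex_angle A <= vertex_angle A k.
  apply: ge_inf; last by exists k.
  by exists 0 => _ [i _ <-]; case: (bnd i) => /ltW.
pose k0 : 'I_n := Ordinal (ltnW (ltnW n2)).
split=> //; last by apply: le_lt_trans (le k0) _; case: (bnd k0).
case: (@arg_minP _ _ _ k0 xpredT (vertex_angle A) erefl) => i _ hi.
apply: (@lt_le_trans _ _ (vertex_angle A i)); first by case: (bnd i).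
apply: lb_le_inf; first by exists (vertex_angle A i); exists i.
by move=> _ [j _ <-]; apply: hi.
Qed.

(** * Pieces of a polygonal tree system *)

(** The vertex S_w(q) of P is still extreme in the smaller set S_w(P), and
    similarities preserve extreme points. *)
Lemma vertex_of_piece (R : realType) (m : nat)
    (S : 'I_m -> 'rV[R]_2 -> 'rV[R]_2) (P : set 'rV[R]_2) (w : seq 'I_m) q :
  (forall i, similarity (S i)) -> (forall i, S i @` P `<=` P) ->
  P q -> vertices P (word_map S w q) -> vertices P q.
Proof.
move=> sS SP Pq vq; apply: (vertices_similarity (word_map_similarity w sS)).
apply: vertices_sub vq; first exact: word_map_sub.
by exists q.
Qed.

(** Cancel the common prefix of w and w' by injectivity. Once the first letters
    differ, the pieces lie in two first-level pieces with a single common point,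
    a vertex of S_i(P), and [vertex_of_piece] carries it down to S_w(P). *)
Lemma pieces_common_point (R : realType) (m : nat)
    (S : 'I_m -> 'rV[R]_2 -> 'rV[R]_2) (P : set 'rV[R]_2) :
  (forall i, similarity (S i)) -> (forall i, S i @` P `<=` P) ->
  (forall i j, i != j ->
        (S i @` P) `&` (S j @` P) = set0 \/
        exists x, [/\ (S i @` P) `&` (S j @` P) = [set x],
                      vertices (S i @` P) x & vertices (S j @` P) x]) ->
  forall (w w' : seq 'I_m) x, size w = size w' -> w != w' ->
  (word_map S w @` P) x -> (word_map S w' @` P) x ->
  (exists2 p, vertices P p & word_map S w p = x) /\
  (forall y, (word_map S w @` P) y -> (word_map S w' @` P) y -> y = x).
Proof.
move=> sS SP disj; elim=> [|i v IH] [|j v'] x //= [sv] ne [q Pq qx] [q' Pq' qx'].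
have Wv z u : P z -> P (word_map S u z).
  by move=> Pz; apply: (word_map_sub SP (w := u)); exists z.
have [ij|ij] := eqVneq i j.
  rewrite -ij in qx' ne *; rewrite eqseq_cons eqxx /= in ne.
  have qq : word_map S v' q' = word_map S v q.
    by apply: (similarity_inj (sS i)); rewrite [LHS]qx' -qx.
  have [[p vp px] un] := IH v' (word_map S v q) sv ne (imageP _ Pq)
    (ex_intro2 _ _ q' Pq' qq).
  split; first by exists p => //; rewrite -qx /= px.
  move=> _ [z Pz <-] [z' Pz' e]; rewrite -qx /=; congr (S i _).
  apply: un; first by exists z.
  by exists z' => //; apply: (similarity_inj (sS i)).
have xi : (S i @` P) x by exists (word_map S v q) => //; apply: Wv.
have xj : (S j @` P) x by exists (word_map S v' q') => //; apply: Wv.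
have [e0|[y [ey vi _]]] := disj i j ij.
  by have : (S i @` P `&` S j @` P) x by []; rewrite e0.
have xy : x = y by have : (S i @` P `&` S j @` P) x by []; rewrite ey.
split.
  exists q => //; apply: (@vertex_of_piece _ _ S P v) => //.
  by apply: (vertices_similarity (sS i)); move: vi; rewrite -xy -qx.
move=> z [z1 Pz1 e1] [z2 Pz2 e2].
have : (S i @` P `&` S j @` P) z.
  by split; [exists (word_map S v z1)|exists (word_map S v' z2)] => //; exact: Wv.
by rewrite ey xy.
Qed.

(** The cones of [disjoint_cones_bound] are spanned, in each of the M pieces, by
    the two polygon vertices adjacent to the vertex x. A vector in two of
    the cones, scaled down enough, ends in both pieces, hence is zero. *)
Lemma distinct_addresses_bound (R : realType) (n m : nat)
    (A : 'I_n -> 'rV[R]_2) (P : set 'rV[R]_2)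
    (S : 'I_m -> 'rV[R]_2 -> 'rV[R]_2) (K : set 'rV[R]_2) (x : 'rV[R]_2)
    (M : nat) (f : 'I_M -> nat -> 'I_m) :
  polygonal_tree_system A P S -> attractor S K -> K `<=` P ->
  injective f -> (forall i, address_map S K (f i) = x) ->
  M%:Z <= Num.ceil (2 * pi / min_vertex_angle A) - 1.
Proof.
move=> [[hP cS] SP disj _ _] hK KP finj fx.
have sS i := similarity_of_contracting (cS i).
have [t0 tpi tmin] := min_vertex_angle_bounds hP.
set t := min_vertex_angle A in t0 tpi tmin *.
(* A single piece need not have x as a vertex; here theta_min < pi suffices. *)
have [M1|M1] := leqP M 1.
  have : 1 < Num.ceil (2 * pi / t) by rewrite ceil_gt_int ltr_pdivlMr //; lra.
  by lia.
have [L hL] := eventually_distinct_prefixes finj.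
pose W i := word_map S (mkseq (f i) L).
have sW i : similarity (W i) by exact: word_map_similarity.
have Wx i : (W i @` P) x.
  by rewrite -(fx i); have [y Ky <-] := address_mapP (f i) sS hK L; exists y => //; apply: KP.
have common i j (ij : i != j) : _ /\ _ :=
  pieces_common_point sS SP disj (etrans (size_mkseq _ _) (esym (size_mkseq _ _)))
    (hL i j ij) (Wx i) (Wx j).
have [_ _ _ Av _] := hP.
have /choice[k kx] i : exists k, W i (A k) = x.
  have [j ij] : exists j, i != j.
    pose o0 : 'I_M := Ordinal (ltnW M1); pose o1 : 'I_M := Ordinal M1.
    by have [->|h] := eqVneq i o0; [exists o1|exists o0].
  by have [[p + px] _] := common i j ij; rewrite -Av => -[k _ kp]; exists k; rewrite kp.
have cP : @convex_set R 'rV[R]_2 P.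
  by case: hP => -> *; apply: convex_hull_convex.
have PA i : P (A i) by have : range A (A i) by []; rewrite Av => -[].
pose u i := W i (A (ord_pred (k i))) - x.
pose v i := W i (A (ordS (k i))) - x.
apply: (@disjoint_cones_bound _ _ u v) => //; first exact: ltW.
- by move=> i; rewrite /u /v -(kx i) similarity_det2 // (vertex_angle_nonflat _ hP).
- by move=> i; rewrite /u /v -(kx i) similarity_angle //; exact: tmin.
move=> i j s1 t1 s2 t2 ij s10 t10 s20 t20 e.
set z := s1 *: u i + _ in e *.
(* Small enough for x + c z to stay inside both triangles. *)
pose c := (1 + (s1 + t1 + s2 + t2))^-1.
have c0 : 0 < c by rewrite invr_gt0; lra.
have tri l (s r : R) : 0 <= s -> 0 <= r -> s + r <= s1 + t1 + s2 + t2 ->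
    (W l @` P) (x + c *: (s *: u l + r *: v l)).
  move=> s0 r0 sr; rewrite scalerDr !scalerA.
  apply: convex_triangle => //.
  - exact: similarity_convex.
  - by exists (A (ord_pred (k l))).
  - by exists (A (ordS (k l))).
  - by rewrite mulr_ge0 // ltW.
  - by rewrite mulr_ge0 // ltW.
  - by rewrite -mulrDr /c ler_pdivrMl ?mulr1; lra.
have [_ un] := common i j ij.
have : x + c *: z = x.
  apply: un; first by apply: tri => //; lra.
  by rewrite e; apply: tri => //; lra.
move=> /eqP; rewrite -subr_eq0 addrAC subrr add0r scaler_eq0 (gt_eqF c0) /=.
by move=> /eqP.
Qed.

Lemma attractor_sub_polygon (R : realType) (n m : nat)
    (A : 'I_n -> 'rV[R]_2) (P : set 'rV[R]_2)
    (S : 'I_m -> 'rV[R]_2 -> 'rV[R]_2) (K : set 'rV[R]_2) :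
  polygonal_tree_system A P S -> attractor S K -> K `<=` P.
Proof.
move=> [[hP cS] SP _ _ _] hK.
apply: (attractor_in_invariant cS) => //; last first.
  by case: hP => _ [p /interior_subset Pp] _ _ _; exists p.
case: hP => -> _ _ _ _; apply: compact_closed; first exact: norm_hausdorff.
exact: convex_hull_compact.
Qed.

(** The critical point S_l(S_w(pi(a))) lies in S_l(P) and in some other
    first-level piece, so it is a vertex of S_l(P); [vertex_of_piece] then takes
    the vertex S_w(pi(a)) of P back to pi(a). *)
Lemma post_critical_vertex (R : realType) (n m : nat)
    (A : 'I_n -> 'rV[R]_2) (P : set 'rV[R]_2)
    (S : 'I_m -> 'rV[R]_2 -> 'rV[R]_2) (K : set 'rV[R]_2) (a : nat -> 'I_m) :
  polygonal_tree_system A P S -> attractor S K ->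
  post_critical_set S K a -> exists k, address_map S K a = A k.
Proof.
move=> hS hK; have KP := attractor_sub_polygon hS hK.
have [[hP cS] SP disj _ _] := hS.
have sS i := similarity_of_contracting (cS i).
have [_ _ _ Av _] := hP.
move=> [[|l w] [] // _ [i [j [ij [/= [yi Kyi iE] [yj Kyj jE]]]]]].
set p := address_map S K a in iE jE *.
have Kp : K p by have [y Ky] := address_mapP a sS hK 0; rewrite /= -/p => <-.
have Pp := KP _ Kp.
suff : vertices P p by rewrite -Av => -[k _ <-]; exists k.
apply: (@vertex_of_piece _ _ S P w) => //.
have Pwp : P (word_map S w p) by apply: (word_map_sub SP (w := w)); exists p.
apply: (vertices_similarity (sS l)).
have [h hl hx] : exists2 h, l != h & (S h @` P) (S l (word_map S w p)).
  have [li|li] := eqVneq l i.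
    by exists j; [rewrite li|exists yj => //; apply: KP].
  by exists i => //; exists yi => //; apply: KP.
have hx' : (S l @` P) (S l (word_map S w p)) by exists (word_map S w p).
have [e0|[y [ey vl _]]] := disj l h hl.
  by have : (S l @` P `&` S h @` P) (S l (word_map S w p)) by []; rewrite e0.
by have : (S l @` P `&` S h @` P) (S l (word_map S w p)) by []; rewrite ey => ->.
Qed.

Unset Implicit Arguments.

Theorem corollary20 (R : realType) (n m : nat) (A : 'I_n -> 'rV[R]_2)
    (P : set 'rV[R]_2) (S : 'I_m -> 'rV[R]_2 -> 'rV[R]_2) (K : set 'rV[R]_2)
    (hS : polygonal_tree_system A P S) (hK : attractor S K) :
  (forall x : 'rV[R]_2, K x ->
     exists2 N : nat,
       ([set a : nat -> 'I_m | address_map S K a = x] #= `I_N)%card &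
       N%:Z <= (n%:Z - 1) * (Num.ceil (2 * pi / min_vertex_angle A) - 1)) /\
  post_critically_finite S K.
Proof.
have KP := attractor_sub_polygon hS hK.
have fiber x : exists2 N : nat,
    ([set a : nat -> 'I_m | address_map S K a = x] #= `I_N)%card &
    N%:Z <= Num.ceil (2 * pi / min_vertex_angle A) - 1.
  apply: finite_card_bound => M f finj fx.
  exact: distinct_addresses_bound hS hK KP finj fx.
have n2 : (2 < n)%N by case: hS => -[/polygon_gt2].
split=> [x _|].
  by have [N Nx Nb] := fiber x; exists N => //; nia.
apply: (@sub_finite_set _ _
  (\bigcup_(k : 'I_n) [set a : nat -> 'I_m | address_map S K a = A k])).
  by move=> a /(post_critical_vertex hS hK)[k ka]; exists k.
apply: bigcup_finite => [|k _]; first exact: finite_finset.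
by have [N Nx _] := fiber (A k); apply/finite_setP; exists N.
Qed.
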